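(* Let $\mathcal C$ be a (strict) braided monoidal category and let $(B_1,B_2,\varphi_{1,2},\varphi_{2,1})$ be a bialgebra admissible tuple (BAT) in $\mathcal C$. Then $(B_1,B_2,\mu_l,\nu_l,\mu_r,\nu_r)$ is a Hopf datum, where $$\mu_l=(\mathrm{id}_{B_1}\otimes\varepsilon_2)\circ\varphi_{2,1},\quad\mu_r=(\varepsilon_1\otimes\mathrm{id}_{B_2})\circ\varphi_{2,1},\quad\nu_l=\varphi_{1,2}\circ(\mathrm{id}_{B_1}\otimes\eta_2),\quad\nu_r=\varphi_{1,2}\circ(\eta_1\otimes\mathrm{id}_{B_2}).$$ Conversely, the resulting Hopf datum can be transformed back into the cross product bialgebra of the BAT: with $$\phi_{1,2}=(\mathrm m_2\otimes\mathrm m_1)\circ(\mathrm{id}_2\otimes\Psi_{1,2}\otimes\mathrm{id}_1)\circ(\nu_l\otimes\nu_r),\quad\phi_{2,1}=(\mu_l\otimes\mu_r)\circ(\mathrm{id}_2\otimes\Psi_{2,1}\otimes\mathrm{id}_1)\circ(\Delta_2\otimes\Delta_1)$$ one has $\phi_{1,2}=\varphi_{1,2}$ and $\phi_{2,1}=\varphi_{2,1}$.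
   Context: $\mathcal C$ has tensor product $\otimes$, unit object $I$, braiding $\Psi$, and idempotents in $\mathcal C$ split. Algebras are unital associative, coalgebras counital coassociative, bialgebras are in the braided sense: $\Delta\circ\mathrm m=(\mathrm m\otimes\mathrm m)\circ(\mathrm{id}\otimes\Psi\otimes\mathrm{id})\circ(\Delta\otimes\Delta)$, with $\varepsilon$ an algebra morphism and $\eta$ a coalgebra morphism. Write $\mathrm{id}_j=\mathrm{id}_{B_j}$, $\Psi_{i,j}=\Psi_{B_i,B_j}$. BAT: objects $B_j$ ($j=1,2$), each with an algebra structure $(\mathrm m_j,\eta_j)$ and a coalgebra structure $(\Delta_j,\varepsilon_j)$ with $\varepsilon_j\circ\eta_j=\mathrm{id}_I$, and morphisms $\varphi_{1,2}:B_1\otimes B_2\to B_2\otimes B_1$, $\varphi_{2,1}:B_2\otimes B_1\to B_1\otimes B_2$, such that $B_1\otimes B_2$ is a bialgebra with $\mathrm m_\times=(\mathrm m_1\otimes\mathrm m_2)\circ(\mathrm{id}_1\otimes\varphi_{2,1}\otimes\mathrm{id}_2)$, $\eta_\times=\eta_1\otimes\eta_2$, $\Delta_\times=(\mathrm{id}_1\otimes\varphi_{1,2}\otimes\mathrm{id}_2)\circ(\Delta_1\otimes\Delta_2)$, $\varepsilon_\times=\varepsilon_1\otimes\varepsilon_2$; this is the cross product bialgebra of the BAT. Hopf datum. A Hopf datum $(B_1,B_2,\mu_l,\nu_l,\mu_r,\nu_r)$ consists of objects $B_1,B_2$, each an algebra $(\mathrm m_j,\eta_j)$ and a coalgebra $(\Delta_j,\varepsilon_j)$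 such that $\varepsilon_j$ is an algebra morphism and $\eta_j$ is a coalgebra morphism; a left $B_2$-module structure $\mu_l:B_2\otimes B_1\to B_1$ and a left $B_2$-comodule structure $\nu_l:B_1\to B_2\otimes B_1$ on $B_1$; a right $B_1$-module structure $\mu_r:B_2\otimes B_1\to B_2$ and a right $B_1$-comodule structure $\nu_r:B_2\to B_2\otimes B_1$ on $B_2$, obeying (with $\phi_{1,2},\phi_{2,1}$ the composites displayed in the claim): - $\mu_r\circ(\eta_2\otimes\mathrm{id}_1)=\eta_2\circ\varepsilon_1=(\mathrm{id}_2\otimes\varepsilon_1)\circ\nu_l$; $\varepsilon_2\circ\mu_r=\varepsilon_2\otimes\varepsilon_1=\varepsilon_1\circ\mu_l$; $\mu_l\circ(\mathrm{id}_2\otimes\eta_1)=\eta_1\circ\varepsilon_2=(\varepsilon_2\otimes\mathrm{id}_1)\circ\nu_r$; $\nu_r\circ\eta_2=\eta_2\otimes\eta_1=\nu_l\circ\eta_1$. - Algebra-coalgebra: $\Delta_1\mathrm m_1=(\mathrm m_1\otimes\mathrm m_1)\circ(\mathrm{id}_1\otimes\mu_l\otimes\mathrm{id}_1\otimes\mathrm{id}_1)\circ(\mathrm{id}_1\otimes\mathrm{id}_2\otimes\Psi_{1,1}\otimes\mathrm{id}_1)\circ(\mathrm{id}_1\otimes\nu_l\otimes\mathrm{id}_1\otimes\mathrm{id}_1)\circ(\Delta_1\otimes\Delta_1)$ and $\Delta_2\mathrm m_2=(\mathrm m_2\otimes\mathrm m_2)\circ(\mathrm{id}_2\otimes\mathrm{id}_2\otimes\mu_r\otimes\mathrm{id}_2)\circ(\mathrm{id}_2\otimes\Psi_{2,2}\otimes\mathrm{id}_1\otimes\mathrm{id}_2)\circ(\mathrm{id}_2\otimes\mathrm{id}_2\otimes\nu_r\otimes\mathrm{id}_2)\circ(\Delta_2\otimes\Delta_2)$.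 - Module-comodule: $\phi_{1,2}\circ\phi_{2,1}=(\mathrm m_2\otimes\mathrm m_1)\circ(\mu_r\otimes\Psi_{1,2}\otimes\mu_l)\circ(\mathrm{id}_2\otimes\Psi_{1,1}\otimes\Psi_{2,2}\otimes\mathrm{id}_1)\circ(\nu_r\otimes\Psi_{2,1}\otimes\nu_l)\circ(\Delta_2\otimes\Delta_1)$. - Module-algebra: $\mu_r(\mathrm m_2\otimes\mathrm{id}_1)=\mathrm m_2(\mu_r\otimes\mathrm{id}_2)(\mathrm{id}_2\otimes\phi_{2,1})$; $\mu_l(\mathrm{id}_2\otimes\mathrm m_1)=\mathrm m_1(\mathrm{id}_1\otimes\mu_l)(\phi_{2,1}\otimes\mathrm{id}_1)$. - Comodule-coalgebra: $(\Delta_2\otimes\mathrm{id}_1)\nu_r=(\mathrm{id}_2\otimes\phi_{1,2})(\nu_r\otimes\mathrm{id}_2)\Delta_2$; $(\mathrm{id}_2\otimes\Delta_1)\nu_l=(\phi_{1,2}\otimes\mathrm{id}_1)(\mathrm{id}_1\otimes\nu_l)\Delta_1$. - Module-coalgebra: $\Delta_2\mu_r=(\mathrm m_2\otimes\mu_r)(\mu_r\otimes\Psi_{2,2}\otimes\mathrm{id}_1)(\mathrm{id}_2\otimes\Psi_{2,1}\otimes\nu_l)(\Delta_2\otimes\Delta_1)$; $\Delta_1\mu_l=(\mu_l\otimes\mathrm m_1)(\mathrm{id}_2\otimes\Psi_{1,1}\otimes\mu_l)(\nu_r\otimes\Psi_{2,1}\otimes\mathrm{id}_1)(\Delta_2\otimes\Delta_1)$.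 - Comodule-algebra: $\nu_r\mathrm m_2=(\mathrm m_2\otimes\mathrm m_1)(\mathrm{id}_2\otimes\Psi_{1,2}\otimes\mu_l)(\nu_r\otimes\Psi_{2,2}\otimes\mathrm{id}_1)(\Delta_2\otimes\nu_r)$; $\nu_l\mathrm m_1=(\mathrm m_2\otimes\mathrm m_1)(\mu_r\otimes\Psi_{1,2}\otimes\mathrm{id}_1)(\mathrm{id}_2\otimes\Psi_{1,1}\otimes\nu_l)(\nu_l\otimes\Delta_1)$. *)

(* Defs.v *)
From mathcomp Require Import ssreflect ssrfun ssrbool.

Set Implicit Arguments.
Unset Strict Implicit.
Unset Printing Implicit Defensive.

(** Categories are presented by one type of morphisms with source and target
    maps, so that in the strict monoidal case [(A ⊠ B) ⊠ D = A ⊠ (B ⊠ D)] and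
    [(f ⊗ g) ⊗ h = f ⊗ (g ⊗ h)] are plain equalities, without any transport of
    morphisms along equalities of objects.  Composition is a total function,
    but nothing is assumed about [g ∘ f] unless [dom g = cod f]. *)
Record category := Category {
  ob : Type;
  mor : Type;
  dom : mor -> ob;
  cod : mor -> ob;
  idm : ob -> mor;
  compm : mor -> mor -> mor;
  dom_id : forall A, dom (idm A) = A;
  cod_id : forall A, cod (idm A) = A;
  dom_comp : forall g f, dom g = cod f -> dom (compm g f) = dom f;
  cod_comp : forall g f, dom g = cod f -> cod (compm g f) = cod g;
  comp_idl : forall f, compm (idm (cod f)) f = f;
  comp_idr : forall f, compm f (idm (dom f)) = f;
  comp_assoc : forall h g f, dom h = cod g -> dom g = cod f ->
    compm h (compm g f) = compm (compm h g) f
}.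

Arguments idm {c} _.
Arguments compm {c} _ _.

Notation "g ∘ f" := (compm g f) (at level 50, left associativity).

Definition hom {C : category} (A B : ob C) (f : mor C) : Prop :=
  dom f = A /\ cod f = B.

Definition split_idempotents (C : category) : Prop :=
  forall (A : ob C) (e : mor C), hom A A e -> e ∘ e = e ->
  exists (X : ob C) (p i : mor C),
    [/\ hom A X p, hom X A i, i ∘ p = e & p ∘ i = idm X].

Record strict_monoidal_category := StrictMonoidalCategory {
  smc_cat :> category;
  unit_ob : ob smc_cat;
  tens_ob : ob smc_cat -> ob smc_cat -> ob smc_cat;
  tens : mor smc_cat -> mor smc_cat -> mor smc_cat;
  tens_obA : forall A B D, tens_ob A (tens_ob B D) = tens_ob (tens_ob A B) D;
  tens_ob_unitl : forall A, tens_ob unit_ob A = A;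
  tens_ob_unitr : forall A, tens_ob A unit_ob = A;
  dom_tens : forall f g, dom (tens f g) = tens_ob (dom f) (dom g);
  cod_tens : forall f g, cod (tens f g) = tens_ob (cod f) (cod g);
  tens_id : forall A B, tens (idm A) (idm B) = idm (tens_ob A B);
  tens_comp : forall g f g' f', dom g = cod f -> dom g' = cod f' ->
    tens (g ∘ f) (g' ∘ f') = tens g g' ∘ tens f f';
  tensA : forall f g h, tens f (tens g h) = tens (tens f g) h;
  tens_unitl : forall f, tens (idm unit_ob) f = f;
  tens_unitr : forall f, tens f (idm unit_ob) = f
}.

Arguments unit_ob {s}.
Arguments tens_ob {s} _ _.
Arguments tens {s} _ _.

Notation "A ⊠ B" := (tens_ob A B) (at level 40, left associativity).
Notation "f ⊗ g" := (tens f g) (at level 40, left associativity).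

(** [Ψ_{I,A} = id_A = Ψ_{A,I}] follows from the hexagons and invertibility. *)
Record strict_braided_category := StrictBraidedCategory {
  sbc_smc :> strict_monoidal_category;
  braid : ob sbc_smc -> ob sbc_smc -> mor sbc_smc;
  braid_hom : forall A B, hom (A ⊠ B) (B ⊠ A) (braid A B);
  braid_iso : forall A B, exists g : mor sbc_smc,
    [/\ hom (B ⊠ A) (A ⊠ B) g, g ∘ braid A B = idm (A ⊠ B)
      & braid A B ∘ g = idm (B ⊠ A)];
  braid_nat : forall f g,
    (g ⊗ f) ∘ braid (dom f) (dom g) = braid (cod f) (cod g) ∘ (f ⊗ g);
  braid_hexl : forall A B D,
    braid (A ⊠ B) D = (braid A D ⊗ idm B) ∘ (idm A ⊗ braid B D);
  braid_hexr : forall A B D,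
    braid A (B ⊠ D) = (idm B ⊗ braid A D) ∘ (braid A B ⊗ idm D)
}.

Arguments braid {s} _ _.

(** The data of an algebra and a coalgebra on one object; no axiom yet. *)
Record algcoalg_data (C : strict_braided_category) := AlgCoalgData {
  carrier :> ob C;
  mult : mor C;
  eta : mor C;
  Delta : mor C;
  eps : mor C
}.

Definition unit_algcoalg (C : strict_braided_category) : algcoalg_data C :=
  {| carrier := unit_ob; mult := idm unit_ob; eta := idm unit_ob;
     Delta := idm unit_ob; eps := idm unit_ob |}.

Section Structures.
Variable C : strict_braided_category.
Implicit Types (A B : algcoalg_data C) (X : ob C).

Record is_algebra A : Prop := IsAlgebra {
  mult_hom : hom (A ⊠ A) A (mult A);
  eta_hom : hom unit_ob A (eta A);
  mult_assoc : mult A ∘ (mult A ⊗ idm A) = mult A ∘ (idm A ⊗ mult A);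
  mult_etal : mult A ∘ (eta A ⊗ idm A) = idm A;
  mult_etar : mult A ∘ (idm A ⊗ eta A) = idm A
}.

Record is_coalgebra A : Prop := IsCoalgebra {
  Delta_hom : hom A (A ⊠ A) (Delta A);
  eps_hom : hom A unit_ob (eps A);
  Delta_coassoc : (Delta A ⊗ idm A) ∘ Delta A = (idm A ⊗ Delta A) ∘ Delta A;
  Delta_epsl : (eps A ⊗ idm A) ∘ Delta A = idm A;
  Delta_epsr : (idm A ⊗ eps A) ∘ Delta A = idm A
}.

Record is_algebra_morphism A B (f : mor C) : Prop := IsAlgebraMorphism {
  algebra_morphism_hom : hom A B f;
  algebra_morphism_mult : f ∘ mult A = mult B ∘ (f ⊗ f);
  algebra_morphism_eta : f ∘ eta A = eta B
}.

Record is_coalgebra_morphism A B (f : mor C) : Prop := IsCoalgebraMorphism {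
  coalgebra_morphism_hom : hom A B f;
  coalgebra_morphism_Delta : Delta B ∘ f = (f ⊗ f) ∘ Delta A;
  coalgebra_morphism_eps : eps B ∘ f = eps A
}.

Record is_bialgebra A : Prop := IsBialgebra {
  bialgebra_algebra : is_algebra A;
  bialgebra_coalgebra : is_coalgebra A;
  bialgebra_Delta_mult : Delta A ∘ mult A =
    (mult A ⊗ mult A) ∘ (idm A ⊗ braid A A ⊗ idm A) ∘ (Delta A ⊗ Delta A);
  bialgebra_eps : is_algebra_morphism A (unit_algcoalg C) (eps A);
  bialgebra_eta : is_coalgebra_morphism (unit_algcoalg C) A (eta A)
}.

Record is_left_module A X (mu : mor C) : Prop := IsLeftModule {
  left_module_hom : hom (A ⊠ X) X mu;
  left_module_mult : mu ∘ (mult A ⊗ idm X) = mu ∘ (idm A ⊗ mu);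
  left_module_eta : mu ∘ (eta A ⊗ idm X) = idm X
}.

Record is_right_module A X (mu : mor C) : Prop := IsRightModule {
  right_module_hom : hom (X ⊠ A) X mu;
  right_module_mult : mu ∘ (idm X ⊗ mult A) = mu ∘ (mu ⊗ idm A);
  right_module_eta : mu ∘ (idm X ⊗ eta A) = idm X
}.

Record is_left_comodule A X (nu : mor C) : Prop := IsLeftComodule {
  left_comodule_hom : hom X (A ⊠ X) nu;
  left_comodule_Delta : (Delta A ⊗ idm X) ∘ nu = (idm A ⊗ nu) ∘ nu;
  left_comodule_eps : (eps A ⊗ idm X) ∘ nu = idm X
}.

Record is_right_comodule A X (nu : mor C) : Prop := IsRightComodule {
  right_comodule_hom : hom X (X ⊠ A) nu;
  right_comodule_Delta : (idm X ⊗ Delta A) ∘ nu = (nu ⊗ idm A) ∘ nu;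
  right_comodule_eps : (idm X ⊗ eps A) ∘ nu = idm X
}.

End Structures.

Section CrossProduct.
Variables (C : strict_braided_category) (B1 B2 : algcoalg_data C).

Local Notation id1 := (idm (carrier B1)).
Local Notation id2 := (idm (carrier B2)).
Local Notation m1 := (mult B1).
Local Notation m2 := (mult B2).
Local Notation eta1 := (eta B1).
Local Notation eta2 := (eta B2).
Local Notation Delta1 := (Delta B1).
Local Notation Delta2 := (Delta B2).
Local Notation eps1 := (eps B1).
Local Notation eps2 := (eps B2).
Local Notation Psi11 := (braid (carrier B1) (carrier B1)).
Local Notation Psi12 := (braid (carrier B1) (carrier B2)).
Local Notation Psi21 := (braid (carrier B2) (carrier B1)).
Local Notation Psi22 := (braid (carrier B2) (carrier B2)).

Definition cross_product (vphi12 vphi21 : mor C) : algcoalg_data C :=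
  {| carrier := B1 ⊠ B2;
     mult := (m1 ⊗ m2) ∘ (id1 ⊗ vphi21 ⊗ id2);
     eta := eta1 ⊗ eta2;
     Delta := (id1 ⊗ vphi12 ⊗ id2) ∘ (Delta1 ⊗ Delta2);
     eps := eps1 ⊗ eps2 |}.

(** Bialgebra admissible tuples. *)
Record is_BAT (vphi12 vphi21 : mor C) : Prop := IsBAT {
  BAT_algebra1 : is_algebra B1;
  BAT_coalgebra1 : is_coalgebra B1;
  BAT_eps_eta1 : eps1 ∘ eta1 = idm unit_ob;
  BAT_algebra2 : is_algebra B2;
  BAT_coalgebra2 : is_coalgebra B2;
  BAT_eps_eta2 : eps2 ∘ eta2 = idm unit_ob;
  BAT_hom12 : hom (B1 ⊠ B2) (B2 ⊠ B1) vphi12;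
  BAT_hom21 : hom (B2 ⊠ B1) (B1 ⊠ B2) vphi21;
  BAT_bialgebra : is_bialgebra (cross_product vphi12 vphi21)
}.

Definition hopf_phi12 (nu_l nu_r : mor C) : mor C :=
  (m2 ⊗ m1) ∘ (id2 ⊗ Psi12 ⊗ id1) ∘ (nu_l ⊗ nu_r).

Definition hopf_phi21 (mu_l mu_r : mor C) : mor C :=
  (mu_l ⊗ mu_r) ∘ (id2 ⊗ Psi21 ⊗ id1) ∘ (Delta2 ⊗ Delta1).

Record is_hopf_datum (mu_l nu_l mu_r nu_r : mor C) : Prop := IsHopfDatum {
  hopf_algebra1 : is_algebra B1;
  hopf_coalgebra1 : is_coalgebra B1;
  hopf_eps1 : is_algebra_morphism B1 (unit_algcoalg C) eps1;
  hopf_eta1 : is_coalgebra_morphism (unit_algcoalg C) B1 eta1;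
  hopf_algebra2 : is_algebra B2;
  hopf_coalgebra2 : is_coalgebra B2;
  hopf_eps2 : is_algebra_morphism B2 (unit_algcoalg C) eps2;
  hopf_eta2 : is_coalgebra_morphism (unit_algcoalg C) B2 eta2;
  hopf_left_module : is_left_module B2 B1 mu_l;
  hopf_left_comodule : is_left_comodule B2 B1 nu_l;
  hopf_right_module : is_right_module B1 B2 mu_r;
  hopf_right_comodule : is_right_comodule B1 B2 nu_r;
  hopf_mu_r_eta2 : mu_r ∘ (eta2 ⊗ id1) = eta2 ∘ eps1;
  hopf_nu_l_eps1 : (id2 ⊗ eps1) ∘ nu_l = eta2 ∘ eps1;
  hopf_eps2_mu_r : eps2 ∘ mu_r = eps2 ⊗ eps1;
  hopf_eps1_mu_l : eps1 ∘ mu_l = eps2 ⊗ eps1;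
  hopf_mu_l_eta1 : mu_l ∘ (id2 ⊗ eta1) = eta1 ∘ eps2;
  hopf_nu_r_eps2 : (eps2 ⊗ id1) ∘ nu_r = eta1 ∘ eps2;
  hopf_nu_r_eta2 : nu_r ∘ eta2 = eta2 ⊗ eta1;
  hopf_nu_l_eta1 : nu_l ∘ eta1 = eta2 ⊗ eta1;
  hopf_algebra_coalgebra1 : Delta1 ∘ m1 =
    (m1 ⊗ m1) ∘ (id1 ⊗ mu_l ⊗ id1 ⊗ id1) ∘ (id1 ⊗ id2 ⊗ Psi11 ⊗ id1)
      ∘ (id1 ⊗ nu_l ⊗ id1 ⊗ id1) ∘ (Delta1 ⊗ Delta1);
  hopf_algebra_coalgebra2 : Delta2 ∘ m2 =
    (m2 ⊗ m2) ∘ (id2 ⊗ id2 ⊗ mu_r ⊗ id2) ∘ (id2 ⊗ Psi22 ⊗ id1 ⊗ id2)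
      ∘ (id2 ⊗ id2 ⊗ nu_r ⊗ id2) ∘ (Delta2 ⊗ Delta2);
  hopf_module_comodule : hopf_phi12 nu_l nu_r ∘ hopf_phi21 mu_l mu_r =
    (m2 ⊗ m1) ∘ (mu_r ⊗ Psi12 ⊗ mu_l) ∘ (id2 ⊗ Psi11 ⊗ Psi22 ⊗ id1)
      ∘ (nu_r ⊗ Psi21 ⊗ nu_l) ∘ (Delta2 ⊗ Delta1);
  hopf_module_algebra_r : mu_r ∘ (m2 ⊗ id1) =
    m2 ∘ (mu_r ⊗ id2) ∘ (id2 ⊗ hopf_phi21 mu_l mu_r);
  hopf_module_algebra_l : mu_l ∘ (id2 ⊗ m1) =
    m1 ∘ (id1 ⊗ mu_l) ∘ (hopf_phi21 mu_l mu_r ⊗ id1);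
  hopf_comodule_coalgebra_r : (Delta2 ⊗ id1) ∘ nu_r =
    (id2 ⊗ hopf_phi12 nu_l nu_r) ∘ (nu_r ⊗ id2) ∘ Delta2;
  hopf_comodule_coalgebra_l : (id2 ⊗ Delta1) ∘ nu_l =
    (hopf_phi12 nu_l nu_r ⊗ id1) ∘ (id1 ⊗ nu_l) ∘ Delta1;
  hopf_module_coalgebra_r : Delta2 ∘ mu_r =
    (m2 ⊗ mu_r) ∘ (mu_r ⊗ Psi22 ⊗ id1) ∘ (id2 ⊗ Psi21 ⊗ nu_l)
      ∘ (Delta2 ⊗ Delta1);
  hopf_module_coalgebra_l : Delta1 ∘ mu_l =
    (mu_l ⊗ m1) ∘ (id2 ⊗ Psi11 ⊗ mu_l) ∘ (nu_r ⊗ Psi21 ⊗ id1)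
      ∘ (Delta2 ⊗ Delta1);
  hopf_comodule_algebra_r : nu_r ∘ m2 =
    (m2 ⊗ m1) ∘ (id2 ⊗ Psi12 ⊗ mu_l) ∘ (nu_r ⊗ Psi22 ⊗ id1)
      ∘ (Delta2 ⊗ nu_r);
  hopf_comodule_algebra_l : nu_l ∘ m1 =
    (m2 ⊗ m1) ∘ (mu_r ⊗ Psi12 ⊗ id1) ∘ (id2 ⊗ Psi11 ⊗ nu_l)
      ∘ (nu_l ⊗ Delta1)
}.

End CrossProduct.

(* Main.v *)
(** Write H = B1 ⊗ B2, with the algebra maps i1 = id ⊗ η2, i2 = η1 ⊗ id and the
    coalgebra maps p1 = id ⊗ ε2, p2 = ε1 ⊗ id.  Then φ21 = m_H (i2 ⊗ i1) and
    φ12 = (p2 ⊗ p1) Δ_H, while p1 m_H only sees p1 of its right argument and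
    Δ_H i1 has its right leg in the image of i1 (and symmetrically for p2, i2).
    The module-algebra and module axioms follow from associativity of m_H.  The
    others compute (p_a ⊗ p_b) Δ_H m_H (i_c ⊗ i_d) by the bialgebra axiom of H,
    the one-sided dependences being used to slide the p's and i's through
    Ψ_{H,H}; in particular (p1 ⊗ p2) Δ_H = id recovers φ21, and (p2 ⊗ p1) Δ_H
    gives the module-comodule condition.

    The notions are invariant under reversing arrows (exchanging m and Δ) and
    under reversing the tensor product (exchanging B1 and B2), so one axiom is
    proved in each orbit of these two symmetries. *)

Require Import Defs.
From mathcomp Require Import ssreflect ssrfun ssrbool.

Set Implicit Arguments.
Unset Strict Implicit.
Unset Printing Implicit Defensive.

(** * Typing of composites and tensor products *)

Section Typing.
Variable C : strict_monoidal_category.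
Implicit Types (A B D : ob C) (f g : mor C).

Lemma hom_id A : hom A A (idm A).
Proof. by split; [exact: dom_id | exact: cod_id]. Qed.

Lemma hom_comp A B B' D g f :
  hom A B f -> hom B' D g -> B' = B -> hom A D (g ∘ f).
Proof.
move=> [df cf] [dg cg] e; have dgf : dom g = cod f by rewrite dg cf.
by split; rewrite ?dom_comp ?cod_comp.
Qed.

Lemma hom_tens A B A' B' f g :
  hom A B f -> hom A' B' g -> hom (A ⊠ A') (B ⊠ B') (f ⊗ g).
Proof. by move=> [<- <-] [<- <-]; split; rewrite ?dom_tens ?cod_tens. Qed.

Lemma hom_conv A B A' B' f : hom A B f -> A = A' -> B = B' -> hom A' B' f.
Proof. by move=> h <- <-. Qed.

Lemma hom_composable A B B' D g f :
  hom A B f -> hom B' D g -> B' = B -> dom g = cod f.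
Proof. by move=> [_ ->] [-> _]. Qed.

End Typing.

Create HintDb hom.

Ltac ob_eq :=
  rewrite /= ?tens_obA ?tens_ob_unitl ?tens_ob_unitr; reflexivity.

(* Typing judgements are inferred from the shape of the morphism; objects are
   only compared at compositions, up to the monoid laws of the tensor. *)
Ltac infer_hom :=
  lazymatch goal with
  | |- hom _ _ (_ ∘ _) => eapply hom_comp; [infer_hom | infer_hom | ob_eq]
  | |- hom _ _ (_ ⊗ _) => eapply hom_tens; infer_hom
  | |- hom _ _ (idm _) => eapply hom_id
  | |- hom _ _ (braid _ _) => eapply braid_hom
  | |- _ => solve [eassumption | eauto with hom nocore]
  end.

(** Goals other than typing conditions are left untouched, so that it can follow any [rewrite] and
    discharge only the side conditions. *)
Ltac typecheck :=
  lazymatch goal with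
  | |- dom _ = cod _ => eapply hom_composable; [infer_hom | infer_hom | ob_eq]
  | |- hom _ _ _ => eapply hom_conv; [infer_hom | ob_eq | ob_eq]
  | |- _ => idtac
  end.

(** * Identity laws and interchange *)

Section Monoidal.
Variable C : strict_monoidal_category.
Implicit Types (A B D : ob C) (f g : mor C).

Lemma comp_id_cod A B f : hom A B f -> idm B ∘ f = f.
Proof. by move=> [_ <-]; exact: comp_idl. Qed.

Lemma comp_id_dom A B f : hom A B f -> f ∘ idm A = f.
Proof. by move=> [<- _]; exact: comp_idr. Qed.

Lemma tens_compl A g f : dom g = cod f ->
  (g ∘ f) ⊗ idm A = (g ⊗ idm A) ∘ (f ⊗ idm A).
Proof.
move=> e; rewrite -tens_comp ?(comp_id_cod (hom_id A)) //.
by rewrite dom_id cod_id.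
Qed.

Lemma tens_compr A g f : dom g = cod f ->
  idm A ⊗ (g ∘ f) = (idm A ⊗ g) ∘ (idm A ⊗ f).
Proof.
move=> e; rewrite -tens_comp ?(comp_id_cod (hom_id A)) //.
by rewrite dom_id cod_id.
Qed.

Lemma tens_splitlr A B A' B' f g : hom A B f -> hom A' B' g ->
  f ⊗ g = (f ⊗ idm B') ∘ (idm A ⊗ g).
Proof.
move=> hf hg; rewrite -tens_comp; typecheck.
by rewrite (comp_id_dom hf) (comp_id_cod hg).
Qed.

Lemma tens_splitrl A B A' B' f g : hom A B f -> hom A' B' g ->
  f ⊗ g = (idm B ⊗ g) ∘ (f ⊗ idm A').
Proof.
move=> hf hg; rewrite -tens_comp; typecheck.
by rewrite (comp_id_cod hf) (comp_id_dom hg).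
Qed.

End Monoidal.

(** * Reversal of arrows and reversal of the tensor product *)

Section Duality.

(** Kept transparent: objects and morphisms are those of [C], so a statement over the dual converts
    to the dual statement over [C]. *)
Definition op_category (C : category) : category.
Proof.
refine (@Category (ob C) (mor C) (@cod C) (@dom C) (@idm C)
  (fun g f => f ∘ g) _ _ _ _ _ _ _).
- exact: cod_id.
- exact: dom_id.
- by move=> g f e; apply: cod_comp.
- by move=> g f e; apply: dom_comp.
- exact: comp_idr.
- exact: comp_idl.
- by move=> h g f e1 e2; rewrite comp_assoc.
Defined.

Definition op_smc (C : strict_monoidal_category) : strict_monoidal_category.
Proof.
refine (@StrictMonoidalCategory (op_category C) unit_ob
  (@tens_ob C) (@tens C) _ _ _ _ _ _ _ _ _ _).
- exact: tens_obA.
- exact: tens_ob_unitl.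
- exact: tens_ob_unitr.
- exact: cod_tens.
- exact: dom_tens.
- exact: tens_id.
- by move=> g f g' f' e e'; apply: tens_comp.
- exact: tensA.
- exact: tens_unitl.
- exact: tens_unitr.
Defined.

(* Both dualities keep the braiding Ψ_{B,A} itself as the new Ψ_{A,B}; no
   inverse braiding is involved. *)
Definition op_braided (C : strict_braided_category) : strict_braided_category.
Proof.
refine (@StrictBraidedCategory (op_smc C)
  (fun A B => braid B A) _ _ _ _ _).
- by move=> A B; split; apply braid_hom.
- move=> A B; have [g [[dg cg] e1 e2]] := @braid_iso C B A.
  by exists g; split.
- by move=> f g; rewrite /= braid_nat.
- by move=> A B D; apply: braid_hexr.
- by move=> A B D; apply: braid_hexl.
Defined.

Definition op_algcoalg (C : strict_braided_category) (A : algcoalg_data C) :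
    algcoalg_data (op_braided C) :=
  @AlgCoalgData (op_braided C) (carrier A) (Delta A) (eps A) (mult A) (eta A).

(** Left-bracketed tensor products become right-bracketed ones here, which is why mirrored
    statements are regrouped by [tensA]. *)
Definition rev_smc (C : strict_monoidal_category) : strict_monoidal_category.
Proof.
refine (@StrictMonoidalCategory C unit_ob
  (fun A B => B ⊠ A) (fun f g => g ⊗ f) _ _ _ _ _ _ _ _ _ _).
- by move=> A B D; rewrite tens_obA.
- exact: tens_ob_unitr.
- exact: tens_ob_unitl.
- by move=> f g; exact: dom_tens.
- by move=> f g; exact: cod_tens.
- by move=> A B; exact: tens_id.
- by move=> g f g' f' e e'; apply: tens_comp.
- by move=> f g h; rewrite tensA.
- exact: tens_unitr.
- exact: tens_unitl.
Defined.

Definition rev_braided (C : strict_braided_category) : strict_braided_category.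
Proof.
refine (@StrictBraidedCategory (rev_smc C)
  (fun A B => braid B A) _ _ _ _ _).
- by move=> A B; apply braid_hom.
- by move=> A B; apply: braid_iso.
- by move=> f g; rewrite /= braid_nat.
- by move=> A B D; apply: braid_hexr.
- by move=> A B D; apply: braid_hexl.
Defined.

Definition rev_algcoalg (C : strict_braided_category) (A : algcoalg_data C) :
    algcoalg_data (rev_braided C) :=
  @AlgCoalgData (rev_braided C) (carrier A) (mult A) (eta A) (Delta A) (eps A).

End Duality.

(** * Dual and mirror forms of the algebraic structures *)

Section DualStructures.
Variable C : strict_braided_category.
Implicit Type A : algcoalg_data C.

Lemma coalgebra_op A : is_algebra A -> is_coalgebra (op_algcoalg A).
Proof. by case=> [[? ?] [? ?] ? ? ?]; split. Qed.

Lemma algebra_op A : is_coalgebra A -> is_algebra (op_algcoalg A).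
Proof. by case=> [[? ?] [? ?] ? ? ?]; split. Qed.

(** The compatibility of [Delta] and [mult] is self-dual up to bracketing of the composite, and the
    conditions on [eps] and [eta] trade places. *)
Lemma bialgebra_op A : is_bialgebra A -> is_bialgebra (op_algcoalg A).
Proof.
case=> ha hc e [[deps ceps] em ee] [[deta ceta] eD eE].
split; [exact: algebra_op | exact: coalgebra_op | | by split | by split].
have [hm hD] := (mult_hom ha, Delta_hom hc).
by rewrite /= e -(@comp_assoc C); typecheck.
Qed.

Lemma algebra_rev A : is_algebra A -> is_algebra (rev_algcoalg A).
Proof. by case=> [[? ?] [? ?] ? ? ?]; split. Qed.

Lemma coalgebra_rev A : is_coalgebra A -> is_coalgebra (rev_algcoalg A).
Proof. by case=> [[? ?] [? ?] ? ? ?]; split. Qed.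

Lemma bialgebra_rev A : is_bialgebra A -> is_bialgebra (rev_algcoalg A).
Proof.
case=> ha hc e [[deps ceps] em ee] [[deta ceta] eD eE].
split; [exact: algebra_rev | exact: coalgebra_rev | | by split | by split].
by rewrite /= e tensA.
Qed.

Variables B1 B2 : algcoalg_data C.

(** [f12] and [f21] trade places because the comultiplication of the cross product becomes its
    multiplication. *)
Lemma BAT_op f12 f21 : is_BAT B1 B2 f12 f21 ->
  is_BAT (op_algcoalg B1) (op_algcoalg B2) f21 f12.
Proof.
case=> a1 c1 e1 a2 c2 e2 [? ?] [? ?] hb.
split=> //; try exact: coalgebra_op; try exact: algebra_op.
exact: bialgebra_op hb.
Qed.

(** Here [B1] and [B2] trade places, while [f12] and [f21] keep their roles: the tensor product is
    reversed at the same time. *)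
Lemma BAT_rev f12 f21 : is_BAT B1 B2 f12 f21 ->
  is_BAT (rev_algcoalg B2) (rev_algcoalg B1) f12 f21.
Proof.
case=> a1 c1 e1 a2 c2 e2 [? ?] [? ?] hb.
split=> //; try exact: coalgebra_rev; try exact: algebra_rev.
have := bialgebra_rev hb.
by rewrite /cross_product /rev_algcoalg /= -!tensA.
Qed.

End DualStructures.

(** * Sliding maps through the braiding *)

Section Crossing.
Variable C : strict_braided_category.

Lemma braid_natural (A A' B B' : ob C) f g : hom A A' f -> hom B B' g ->
  (g ⊗ f) ∘ braid A B = braid A' B' ∘ (f ⊗ g).
Proof. by move=> [<- <-] [<- <-]; exact: braid_nat. Qed.

(** Naturality carries the inner maps [b] and [c] across the braiding, where they meet [g] and [f];
    the outer pairs [a], [e] and [d], [h] never cross. *)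
Lemma tens_braid_tens (H U V U1 U2 V1 V2 X X1 X2 Y Y1 Y2 : ob C)
    s t a b c d e f g h k l :
  hom (X1 ⊠ X2) X s -> hom (Y1 ⊠ Y2) Y t ->
  hom H X1 a -> hom H X2 b -> hom H Y1 c -> hom H Y2 d ->
  hom U1 H e -> hom U2 H f -> hom V1 H g -> hom V2 H h ->
  hom U (U1 ⊠ U2) k -> hom V (V1 ⊠ V2) l ->
  ((s ∘ (a ⊗ b)) ⊗ (t ∘ (c ⊗ d))) ∘ (idm H ⊗ braid H H ⊗ idm H)
    ∘ (((e ⊗ f) ∘ k) ⊗ ((g ⊗ h) ∘ l))
  = ((s ∘ ((a ∘ e) ⊗ idm X2)) ⊗ (t ∘ (idm Y1 ⊗ (d ∘ h))))
    ∘ (idm U1 ⊗ braid Y1 X2 ⊗ idm V2)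
    ∘ (((idm U1 ⊗ (c ∘ f)) ∘ k) ⊗ (((b ∘ g) ⊗ idm V2) ∘ l)).
Proof.
move=> hs ht ha hb hc hd he hf hg hh hk hl.
have core : (a ⊗ b ⊗ (c ⊗ d)) ∘ (idm H ⊗ braid H H ⊗ idm H)
      ∘ (e ⊗ f ⊗ (g ⊗ h))
    = ((a ∘ e) ⊗ idm X2 ⊗ (idm Y1 ⊗ (d ∘ h)))
      ∘ (idm U1 ⊗ braid Y1 X2 ⊗ idm V2)
      ∘ ((idm U1 ⊗ (c ∘ f)) ⊗ ((b ∘ g) ⊗ idm V2)).
  rewrite !tensA -(tensA a) -(tensA e) -(tensA (a ∘ e)).
  rewrite -(tensA (idm U1) (c ∘ f)) tens_id -!tens_comp; typecheck.
  have hae : hom U1 X1 (a ∘ e) by typecheck.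
  have hdh : hom V2 Y2 (d ∘ h) by typecheck.
  rewrite (braid_natural hc hb) (comp_id_dom ha) (comp_id_dom hd).
  rewrite !(comp_id_dom hae) !(comp_id_dom hdh) (comp_id_cod (braid_hom _ _)).
  by rewrite (tens_comp (f := f)) ?comp_assoc; typecheck.
rewrite !(tens_comp (g := s)) ?(tens_comp (f := k)); typecheck.
rewrite !comp_assoc; typecheck.
rewrite -[in LHS](comp_assoc (h := s ⊗ t)); typecheck.
rewrite -[in LHS](comp_assoc (h := s ⊗ t)); typecheck.
rewrite -[in RHS](comp_assoc (h := s ⊗ t)); typecheck.
rewrite -[in RHS](comp_assoc (h := s ⊗ t)); typecheck.
by rewrite core.
Qed.

(* q ∘ m, resp. Δ ∘ u, only depends on its two arguments, resp. legs, through
   a and b, resp. e and f. *)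
Definition mult_factors (H : algcoalg_data C) q s a b X X1 X2 : Prop :=
  [/\ hom H X q, hom (X1 ⊠ X2) X s, hom H X1 a, hom H X2 b
    & q ∘ mult H = s ∘ (a ⊗ b)].

Definition comult_factors (H : algcoalg_data C) u k e f U U1 U2 : Prop :=
  [/\ hom U H u, hom U (U1 ⊠ U2) k, hom U1 H e, hom U2 H f
    & Delta H ∘ u = (e ⊗ f) ∘ k].

(** The bialgebra axiom followed by sliding. It is used with [q], [r] among the projections of the
    cross product and [u], [v] among its injections. *)
Lemma bialgebra_comult_mult (H : algcoalg_data C)
    q s a b X X1 X2 r t c d Y Y1 Y2 u k e f U U1 U2 v l g h V V1 V2 :
  is_bialgebra H ->
  mult_factors H q s a b X X1 X2 -> mult_factors H r t c d Y Y1 Y2 ->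
  comult_factors H u k e f U U1 U2 -> comult_factors H v l g h V V1 V2 ->
  (q ⊗ r) ∘ Delta H ∘ (mult H ∘ (u ⊗ v))
  = ((s ∘ ((a ∘ e) ⊗ idm X2)) ⊗ (t ∘ (idm Y1 ⊗ (d ∘ h))))
    ∘ (idm U1 ⊗ braid Y1 X2 ⊗ idm V2)
    ∘ (((idm U1 ⊗ (c ∘ f)) ∘ k) ⊗ (((b ∘ g) ⊗ idm V2) ∘ l)).
Proof.
move=> hb [hq hs ha hb' eq] [hr ht hc hd er] [hu hk he hf eu] [hv hl hg hh ev].
have hm := mult_hom (bialgebra_algebra hb).
have hD := Delta_hom (bialgebra_coalgebra hb).
rewrite -(@tens_braid_tens H U V U1 U2 V1 V2 X X1 X2 Y Y1 Y2) //.
rewrite -eq -er -eu -ev !tens_comp; typecheck.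
rewrite !comp_assoc; typecheck.
rewrite -(comp_assoc (h := q ⊗ r)); typecheck.
by rewrite (bialgebra_Delta_mult hb) !comp_assoc; typecheck.
Qed.

End Crossing.

#[local] Hint Resolve mult_hom eta_hom Delta_hom eps_hom : hom.
#[local] Hint Resolve bialgebra_algebra bialgebra_coalgebra : hom.
#[local] Hint Resolve BAT_algebra1 BAT_coalgebra1 BAT_algebra2 BAT_coalgebra2
  BAT_bialgebra BAT_hom12 BAT_hom21 : hom.

(** * Injections, projections, actions and coactions *)

Section CrossProductMaps.
Variables (C : strict_braided_category) (B1 B2 : algcoalg_data C).
Variables (f12 f21 : mor C).

Definition inj1 : mor C := idm B1 ⊗ eta B2.
Definition inj2 : mor C := eta B1 ⊗ idm B2.
Definition proj1 : mor C := idm B1 ⊗ eps B2.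
Definition proj2 : mor C := eps B1 ⊗ idm B2.

Definition act_l : mor C := proj1 ∘ f21.
Definition act_r : mor C := proj2 ∘ f21.
Definition coact_l : mor C := f12 ∘ inj1.
Definition coact_r : mor C := f12 ∘ inj2.

(* These describe p_j ∘ m_H and Δ_H ∘ i_j: p1 ∘ m_H = lift1 ∘ (id ⊗ p1),
   Δ_H ∘ i1 = (id ⊗ i1) ∘ colift1, and mirror images for index 2. *)
Definition lift1 : mor C := mult B1 ∘ (idm B1 ⊗ act_l).
Definition lift2 : mor C := mult B2 ∘ (act_r ⊗ idm B2).
Definition colift1 : mor C := (idm B1 ⊗ coact_l) ∘ Delta B1.
Definition colift2 : mor C := (coact_r ⊗ idm B2) ∘ Delta B2.

Hypothesis hBAT : is_BAT B1 B2 f12 f21.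

Lemma inj1_hom : hom B1 (B1 ⊠ B2) inj1.
Proof. rewrite /inj1; typecheck. Qed.
Lemma inj2_hom : hom B2 (B1 ⊠ B2) inj2.
Proof. rewrite /inj2; typecheck. Qed.
Lemma proj1_hom : hom (B1 ⊠ B2) B1 proj1.
Proof. rewrite /proj1; typecheck. Qed.
Lemma proj2_hom : hom (B1 ⊠ B2) B2 proj2.
Proof. rewrite /proj2; typecheck. Qed.
Lemma act_l_hom : hom (B2 ⊠ B1) B1 act_l.
Proof. rewrite /act_l /proj1; typecheck. Qed.
Lemma act_r_hom : hom (B2 ⊠ B1) B2 act_r.
Proof. rewrite /act_r /proj2; typecheck. Qed.
Lemma coact_l_hom : hom B1 (B2 ⊠ B1) coact_l.
Proof. rewrite /coact_l /inj1; typecheck. Qed.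
Lemma coact_r_hom : hom B2 (B2 ⊠ B1) coact_r.
Proof. rewrite /coact_r /inj2; typecheck. Qed.

End CrossProductMaps.

#[local] Hint Resolve inj1_hom inj2_hom proj1_hom proj2_hom : hom.
#[local] Hint Resolve act_l_hom act_r_hom coact_l_hom coact_r_hom : hom.

(** * Multiplication of the cross product on the images of the factors *)

Section CrossProductMult.
Variables (C : strict_braided_category) (B1 B2 : algcoalg_data C).
Variables (f12 f21 : mor C).
Hypothesis hBAT : is_BAT B1 B2 f12 f21.
Local Notation H := (cross_product B1 B2 f12 f21).
Local Notation id1 := (idm B1).
Local Notation id2 := (idm B2).

Lemma cross_mult_tens X Y Z W a b c d :
  hom X B1 a -> hom Y B2 b -> hom Z B1 c -> hom W B2 d ->
  mult H ∘ ((a ⊗ b) ⊗ (c ⊗ d))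
  = (mult B1 ⊗ mult B2) ∘ (a ⊗ (f21 ∘ (b ⊗ c)) ⊗ d).
Proof.
move=> ha hb hc hd.
rewrite /= -comp_assoc; typecheck.
congr (_ ∘ _); rewrite tensA -(tensA a) -!tens_comp; typecheck.
by rewrite (comp_id_cod ha) (comp_id_cod hd).
Qed.

(** Both outer units are absorbed by the unit laws of [B1] and [B2]; this extracts [f21] from the
    multiplication of [H]. *)
Lemma mult_eta_sandwich X f : hom X (B1 ⊠ B2) f ->
  (mult B1 ⊗ mult B2) ∘ (eta B1 ⊗ f ⊗ eta B2) = f.
Proof.
move=> hf.
have -> : eta B1 ⊗ f ⊗ eta B2 = (eta B1 ⊗ id1 ⊗ (id2 ⊗ eta B2)) ∘ f.
  rewrite tensA -[in RHS](tensA (eta B1)) tens_id.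
  (* Padding [f] with identities of the unit object gives it the three blocks that interchange
     needs. *)
  have ef : f = idm unit_ob ⊗ f ⊗ idm unit_ob by rewrite tens_unitl tens_unitr.
  rewrite [in RHS]ef -!tens_comp; typecheck.
  rewrite (comp_id_cod hf) !(comp_id_dom (eta_hom _)) //; eauto with hom nocore.
rewrite comp_assoc; typecheck.
rewrite -tens_comp; typecheck.
rewrite (mult_etal (BAT_algebra1 hBAT)) (mult_etar (BAT_algebra2 hBAT)) tens_id.
exact: comp_id_cod hf.
Qed.

Lemma cross_mult_inj21 : mult H ∘ (inj2 B1 B2 ⊗ inj1 B1 B2) = f21.
Proof.
rewrite (@cross_mult_tens unit_ob B2 B1 unit_ob); typecheck.
rewrite tens_id (comp_id_dom (BAT_hom21 hBAT)).
exact: mult_eta_sandwich (BAT_hom21 hBAT).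
Qed.

(** Inserting outer units turns the left side into the product of [eta H] with [inj1], and [eta H]
    is a left unit. *)
Lemma cross_eta2 : f21 ∘ (eta B2 ⊗ id1) = inj1 B1 B2.
Proof.
rewrite -[LHS](@mult_eta_sandwich B1); typecheck.
rewrite -(@cross_mult_tens unit_ob unit_ob B1 unit_ob); typecheck.
have -> : eta B1 ⊗ eta B2 ⊗ (id1 ⊗ eta B2)
  = (eta H ⊗ idm H) ∘ (idm unit_ob ⊗ inj1 B1 B2).
  rewrite -tens_comp; typecheck.
  rewrite (comp_id_cod (inj1_hom hBAT)).
  rewrite (comp_id_dom (A := unit_ob) (B := H)) //.
  exact: eta_hom (bialgebra_algebra (BAT_bialgebra hBAT)).
rewrite comp_assoc; typecheck.
rewrite (mult_etal (bialgebra_algebra (BAT_bialgebra hBAT))) tens_unitl.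
exact: comp_id_cod (inj1_hom hBAT).
Qed.

Lemma cross_mult_inj1 :
  mult H ∘ (inj1 B1 B2 ⊗ inj1 B1 B2) = inj1 B1 B2 ∘ mult B1.
Proof.
rewrite (@cross_mult_tens B1 unit_ob B1 unit_ob); typecheck.
rewrite cross_eta2 /inj1 tensA -tensA -tens_comp; typecheck.
have h1 := BAT_algebra1 hBAT; have h2 := BAT_algebra2 hBAT.
have -> : mult B2 ∘ (eta B2 ⊗ eta B2) = eta B2.
  rewrite (@tens_splitrl _ unit_ob B2 unit_ob B2); typecheck.
  rewrite comp_assoc; typecheck.
  by rewrite (mult_etar h2) tens_unitr (comp_id_cod (eta_hom h2)).
rewrite tens_id (comp_id_dom (mult_hom h1)).
rewrite -{2}(tens_unitr (mult B1)) -tens_comp; typecheck.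
by rewrite (comp_id_cod (mult_hom h1)) (comp_id_dom (eta_hom h2)).
Qed.

Lemma inj1_eps1 : eps H ∘ inj1 B1 B2 = eps B1.
Proof.
rewrite /= -tens_comp; typecheck.
rewrite (BAT_eps_eta2 hBAT) tens_unitr.
exact: comp_id_dom (eps_hom (BAT_coalgebra1 hBAT)).
Qed.

(** [eps B1] is [eps H] composed with [inj1], and both are multiplicative; the unit condition is
    part of the BAT. *)
Lemma eps1_algebra_morphism : is_algebra_morphism B1 (unit_algcoalg C) (eps B1).
Proof.
have he := bialgebra_eps (BAT_bialgebra hBAT).
split; [typecheck | | exact: BAT_eps_eta1 hBAT].
rewrite -{1}inj1_eps1 -comp_assoc; typecheck.
rewrite -cross_mult_inj1 comp_assoc; typecheck.
rewrite (algebra_morphism_mult he) -[mult (unit_algcoalg C)]/(idm unit_ob).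
rewrite -comp_assoc; typecheck.
by rewrite -tens_comp ?inj1_eps1; typecheck.
Qed.

Lemma cross_act_l_eta2 : act_l B1 B2 f21 ∘ (eta B2 ⊗ id1) = id1.
Proof.
rewrite -comp_assoc; typecheck.
rewrite cross_eta2 /proj1 -tens_comp; typecheck.
by rewrite (BAT_eps_eta2 hBAT) tens_unitr (comp_id_cod (hom_id _)).
Qed.

(** Together with [lift1_inj2], and their dual and mirror forms, this identifies the outer terms
    left by the sliding formula. *)
Lemma lift1_inj1 : lift1 B1 B2 f21 ∘ (inj1 B1 B2 ⊗ id1) = mult B1.
Proof.
rewrite /lift1 -comp_assoc; typecheck.
rewrite /inj1 -tensA -tens_comp; typecheck.
rewrite cross_act_l_eta2 (comp_id_cod (hom_id _)) tens_id.
exact: comp_id_dom (mult_hom (BAT_algebra1 hBAT)).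
Qed.

Lemma lift1_inj2 : lift1 B1 B2 f21 ∘ (inj2 B1 B2 ⊗ id1) = act_l B1 B2 f21.
Proof.
have h1 := BAT_algebra1 hBAT; have ha := act_l_hom hBAT.
rewrite /lift1 -comp_assoc; typecheck.
rewrite /inj2 -tensA -tens_comp; typecheck.
rewrite tens_id (comp_id_dom ha) (comp_id_cod (eta_hom h1)).
rewrite (tens_splitlr (eta_hom h1) ha) comp_assoc; typecheck.
by rewrite (mult_etal h1) tens_unitl (comp_id_cod ha).
Qed.

Lemma proj2_inj1 : proj2 B1 B2 ∘ inj1 B1 B2 = eta B2 ∘ eps B1.
Proof.
have he := eps_hom (BAT_coalgebra1 hBAT).
have hh := eta_hom (BAT_algebra2 hBAT).
rewrite /proj2 /inj1 -tens_comp; typecheck.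
rewrite (comp_id_dom he) (comp_id_cod hh).
by rewrite (tens_splitrl he hh) tens_unitl tens_unitr.
Qed.

Lemma act_r_eta2 : act_r B1 B2 f21 ∘ (eta B2 ⊗ id1) = eta B2 ∘ eps B1.
Proof. by rewrite -comp_assoc ?cross_eta2 ?proj2_inj1; typecheck. Qed.

Lemma proj1_inj1 : proj1 B1 B2 ∘ inj1 B1 B2 = id1.
Proof.
rewrite /proj1 /inj1 -tens_comp; typecheck.
by rewrite (BAT_eps_eta2 hBAT) tens_unitr (comp_id_cod (hom_id _)).
Qed.

(** [f21] merely swaps the two units, and these are then absorbed. The dual form is what recovers
    [f21] from the Hopf datum. *)
Lemma cross_mult_inj12 : mult H ∘ (inj1 B1 B2 ⊗ inj2 B1 B2) = idm (B1 ⊠ B2).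
Proof.
have h1 := BAT_algebra1 hBAT; have h2 := BAT_algebra2 hBAT.
rewrite (cross_mult_tens (hom_id _) (eta_hom h2) (eta_hom h1) (hom_id _)).
have -> : f21 ∘ (eta B2 ⊗ eta B1) = eta B1 ⊗ eta B2.
  rewrite (@tens_splitlr _ unit_ob B2 unit_ob B1); typecheck.
  rewrite comp_assoc ?cross_eta2; typecheck.
  rewrite tens_unitl -{1}(tens_unitr (eta B1)) /inj1 -tens_comp; typecheck.
  by rewrite (comp_id_cod (eta_hom h1)) (comp_id_dom (eta_hom h2)).
rewrite tensA -tensA -tens_comp; typecheck.
by rewrite (mult_etar h1) (mult_etal h2) tens_id.
Qed.

Lemma lift1_hom : hom (B1 ⊠ B2 ⊠ B1) B1 (lift1 B1 B2 f21).
Proof. rewrite /lift1; typecheck. Qed.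
Lemma lift2_hom : hom (B2 ⊠ (B1 ⊠ B2)) B2 (lift2 B1 B2 f21).
Proof. rewrite /lift2; typecheck. Qed.
Lemma colift1_hom : hom B1 (B1 ⊠ B2 ⊠ B1) (colift1 B1 B2 f12).
Proof. rewrite /colift1; typecheck. Qed.
Lemma colift2_hom : hom B2 (B2 ⊠ (B1 ⊠ B2)) (colift2 B1 B2 f12).
Proof. rewrite /colift2; typecheck. Qed.

End CrossProductMult.

#[local] Hint Resolve lift1_hom lift2_hom colift1_hom colift2_hom : hom.

(** * Counits and units carried back from the dual categories *)

(** The records over the two categories are not convertible, only their fields are, hence the
    repackaging. *)
Lemma unit_algebra_morphism_rev (C : strict_braided_category)
    (A : algcoalg_data C) f :
  @is_algebra_morphism (rev_braided C) (rev_algcoalg A) (unit_algcoalg _) f ->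
  is_algebra_morphism A (unit_algcoalg C) f.
Proof. by case=> [[? ?] ? ?]; split. Qed.

Lemma unit_coalgebra_morphism_op (C : strict_braided_category)
    (A : algcoalg_data C) f :
  @is_algebra_morphism (op_braided C) (op_algcoalg A) (unit_algcoalg _) f ->
  is_coalgebra_morphism (unit_algcoalg C) A f.
Proof. by case=> [[? ?] ? ?]; split. Qed.

Lemma unit_algebra_morphism_mult (C : strict_braided_category)
    (A : algcoalg_data C) f :
  is_algebra_morphism A (unit_algcoalg C) f -> f ∘ mult A = f ⊗ f.
Proof.
case=> hf -> _; rewrite [mult _]/=; apply: (comp_id_cod (A := A ⊠ A)).
rewrite -[X in hom _ X](tens_ob_unitl unit_ob); exact: (hom_tens hf hf).
Qed.

(** * The module laws *)

Section CrossProductAction.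
Variables (C : strict_braided_category) (B1 B2 : algcoalg_data C).
Variables (f12 f21 : mor C).
Hypothesis hBAT : is_BAT B1 B2 f12 f21.
Local Notation H := (cross_product B1 B2 f12 f21).
Local Notation id1 := (idm B1).
Local Notation id2 := (idm B2).
Local Notation idH := (idm (B1 ⊠ B2)).
Local Notation i2 := (inj2 B1 B2).
Local Notation p1 := (proj1 B1 B2).
Local Notation mu_l := (act_l B1 B2 f21).
Local Notation l1 := (lift1 B1 B2 f21).

Lemma eps2_algebra_morphism : is_algebra_morphism B2 (unit_algcoalg C) (eps B2).
Proof.
exact: unit_algebra_morphism_rev (eps1_algebra_morphism (BAT_rev hBAT)).
Qed.

Lemma cross_mult_inj2 : mult H ∘ (i2 ⊗ i2) = i2 ∘ mult B2.
Proof. by have := cross_mult_inj1 (BAT_rev hBAT); rewrite /= -tensA. Qed.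

(** Multiplicativity of [eps B2] splits it in two: one copy turns [f21] into [mu_l], the other forms
    [p1] on the right argument. *)
Lemma proj1_cross_mult : p1 ∘ mult H = l1 ∘ (idH ⊗ p1).
Proof.
have he2 := unit_algebra_morphism_mult eps2_algebra_morphism.
have h1 := mult_hom (BAT_algebra1 hBAT).
have e2 := eps_hom (BAT_coalgebra2 hBAT).
rewrite [mult H]/= comp_assoc; typecheck.
rewrite {1}/proj1 -tens_comp; typecheck.
rewrite he2 (comp_id_cod h1).
have -> : mult B1 ⊗ (eps B2 ⊗ eps B2)
    = mult B1 ∘ (id1 ⊗ p1 ⊗ eps B2).
  rewrite (tens_splitlr h1 (hom_tens e2 e2)) tens_ob_unitl tens_unitr.
  by rewrite /proj1 -tens_id !tensA.
rewrite -comp_assoc; typecheck.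
rewrite -!tens_comp; typecheck.
rewrite /lift1 -comp_assoc; typecheck.
congr (_ ∘ _).
have -> : idH ⊗ p1 = id1 ⊗ idm (B2 ⊠ B1) ⊗ eps B2.
  by rewrite -!tens_id /proj1 !tensA.
rewrite -[id1 ⊗ mu_l]tens_unitr -!tens_comp; typecheck.
rewrite -/mu_l (comp_id_dom e2).
rewrite (comp_id_cod e2) (comp_id_cod (hom_id _)).
by rewrite (comp_id_dom (act_l_hom hBAT)).
Qed.

(** The left side is [eps H] applied to the product of [i2] and [inj1], and [eps H] is
    multiplicative. *)
Lemma eps1_act_l : eps B1 ∘ mu_l = eps B2 ⊗ eps B1.
Proof.
have he := unit_algebra_morphism_mult (bialgebra_eps (BAT_bialgebra hBAT)).
have e1 := eps_hom (BAT_coalgebra1 hBAT).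
have e2 := eps_hom (BAT_coalgebra2 hBAT).
rewrite /act_l -(cross_mult_inj21 hBAT) comp_assoc; typecheck.
have -> : eps B1 ∘ p1 = eps H.
  by rewrite /= (tens_splitlr e1 e2) tens_unitr.
rewrite comp_assoc; typecheck.
rewrite he -tens_comp; typecheck.
have -> : eps H ∘ i2 = eps B2 := inj1_eps1 (BAT_rev hBAT).
by rewrite (inj1_eps1 hBAT).
Qed.

(** Associativity of [H] on [i2], [i2], [inj1]. Applying [p1] gives the module law of [mu_l];
    applying [proj2] gives the module-algebra law of the right action. *)
Lemma cross_mult2 : f21 ∘ (mult B2 ⊗ id1) = mult H ∘ (i2 ⊗ f21).
Proof.
have hH := bialgebra_algebra (BAT_bialgebra hBAT).
rewrite -{1}(cross_mult_inj21 hBAT) -comp_assoc; typecheck.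
rewrite -tens_comp; typecheck.
rewrite -cross_mult_inj2 (comp_id_dom (inj1_hom hBAT)).
rewrite -{1}(comp_id_cod (inj1_hom hBAT)) tens_comp; typecheck.
rewrite comp_assoc; typecheck.
rewrite (mult_assoc hH) -comp_assoc; typecheck.
rewrite -tensA -tens_comp; typecheck.
by rewrite (cross_mult_inj21 hBAT) (comp_id_cod (inj2_hom hBAT)).
Qed.

Lemma act_l_mult : mu_l ∘ (mult B2 ⊗ id1) = mu_l ∘ (id2 ⊗ mu_l).
Proof.
rewrite /act_l -comp_assoc; typecheck.
rewrite cross_mult2 comp_assoc; typecheck.
rewrite proj1_cross_mult -comp_assoc; typecheck.
rewrite -tens_comp; typecheck.
rewrite -/mu_l (comp_id_cod (inj2_hom hBAT)).
rewrite (tens_splitlr (inj2_hom hBAT) (act_l_hom hBAT)) comp_assoc; typecheck.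
by rewrite (lift1_inj2 hBAT).
Qed.

End CrossProductAction.

(** * Dual and mirror forms, then the compatibility axioms *)

Section CrossProductHopf.
Variables (C : strict_braided_category) (B1 B2 : algcoalg_data C).
Variables (f12 f21 : mor C).
Hypothesis hBAT : is_BAT B1 B2 f12 f21.
Local Notation H := (cross_product B1 B2 f12 f21).
Local Notation Psi11 := (braid (carrier B1) (carrier B1)).
Local Notation Psi12 := (braid (carrier B1) (carrier B2)).
Local Notation Psi21 := (braid (carrier B2) (carrier B1)).
Local Notation Psi22 := (braid (carrier B2) (carrier B2)).
Local Notation id1 := (idm B1).
Local Notation id2 := (idm B2).
Local Notation idH := (idm (B1 ⊠ B2)).
Local Notation i1 := (inj1 B1 B2).
Local Notation i2 := (inj2 B1 B2).
Local Notation p1 := (proj1 B1 B2).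
Local Notation p2 := (proj2 B1 B2).
Local Notation mu_l := (act_l B1 B2 f21).
Local Notation mu_r := (act_r B1 B2 f21).
Local Notation nu_l := (coact_l B1 B2 f12).
Local Notation nu_r := (coact_r B1 B2 f12).
Local Notation l1 := (lift1 B1 B2 f21).
Local Notation l2 := (lift2 B1 B2 f21).
Local Notation c1 := (colift1 B1 B2 f12).
Local Notation c2 := (colift2 B1 B2 f12).

Let hR := BAT_rev hBAT.
Let hO := BAT_op hBAT.
Let hRO := BAT_rev hO.

Lemma cross_comult_proj1 : (p1 ⊗ p1) ∘ Delta H = Delta B1 ∘ p1.
Proof. exact: cross_mult_inj1 hO. Qed.

Lemma cross_comult_proj2 : (p2 ⊗ p2) ∘ Delta H = Delta B2 ∘ p2.
Proof. by have := cross_mult_inj1 hRO; rewrite /= -tensA. Qed.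

Lemma cross_comult_proj21 : (p2 ⊗ p1) ∘ Delta H = f12.
Proof. exact: cross_mult_inj21 hO. Qed.

Lemma cross_comult_proj12 : (p1 ⊗ p2) ∘ Delta H = idH.
Proof. exact: cross_mult_inj12 hO. Qed.

Lemma proj2_cross_mult : p2 ∘ mult H = l2 ∘ (p2 ⊗ idH).
Proof. by have := proj1_cross_mult hR; rewrite /= -tensA. Qed.

Lemma cross_comult_inj1 : Delta H ∘ i1 = (idH ⊗ i1) ∘ c1.
Proof. exact: proj1_cross_mult hO. Qed.

Lemma cross_comult_inj2 : Delta H ∘ i2 = (i2 ⊗ idH) ∘ c2.
Proof. by have := proj1_cross_mult hRO; rewrite /= -tensA. Qed.

Lemma lift2_inj1 : l2 ∘ (id2 ⊗ i1) = mu_r.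
Proof. exact: lift1_inj2 hR. Qed.

Lemma colift1_proj1 : (p1 ⊗ id1) ∘ c1 = Delta B1.
Proof. exact: lift1_inj1 hO. Qed.

Lemma colift2_proj2 : (id2 ⊗ p2) ∘ c2 = Delta B2.
Proof. exact: lift1_inj1 hRO. Qed.

Lemma proj2_inj2 : p2 ∘ i2 = id2.
Proof. exact: proj1_inj1 hR. Qed.

Let hb := BAT_bialgebra hBAT.

Lemma proj1_factors : mult_factors H p1 l1 idH p1 B1 (B1 ⊠ B2) B1.
Proof. by split; typecheck; exact: proj1_cross_mult. Qed.

Lemma proj2_factors : mult_factors H p2 l2 p2 idH B2 B2 (B1 ⊠ B2).
Proof. by split; typecheck; exact: proj2_cross_mult. Qed.

Lemma inj1_factors : comult_factors H i1 c1 idH i1 B1 (B1 ⊠ B2) B1.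
Proof. by split; typecheck; exact: cross_comult_inj1. Qed.

Lemma inj2_factors : comult_factors H i2 c2 i2 idH B2 B2 (B1 ⊠ B2).
Proof. by split; typecheck; exact: cross_comult_inj2. Qed.

(** With [p1 ⊗ p2] outside, [Delta H] disappears. On the other side [i2] and [i1] cut the lifts down
    to the actions, and [p2] and [p1] cut the colifts down to the comultiplications. *)
Lemma hopf_phi21_act : hopf_phi21 B1 B2 mu_l mu_r = f21.
Proof.
have := bialgebra_comult_mult hb proj1_factors proj2_factors
  inj2_factors inj1_factors.
rewrite cross_comult_proj12 (cross_mult_inj21 hBAT).
(* [f21] also occurs inside [mu_l] and [mu_r], so only the right-hand side is rewritten. *)
rewrite (comp_id_cod (BAT_hom21 hBAT)) => e; rewrite [RHS]e.
rewrite !(comp_id_cod (inj1_hom hBAT)) !(comp_id_cod (inj2_hom hBAT)).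
rewrite !(comp_id_dom (proj1_hom hBAT)) !(comp_id_dom (proj2_hom hBAT)).
by rewrite colift1_proj1 colift2_proj2 lift2_inj1 (lift1_inj2 hBAT).
Qed.

(** With [p2 ⊗ p1] outside, every inserted composite is an identity, so the full braiding of [H]
    with itself survives. *)
Lemma act_module_comodule :
  f12 ∘ f21 = (l2 ⊗ l1) ∘ (id2 ⊗ braid (B1 ⊠ B2) (B1 ⊠ B2) ⊗ id1) ∘ (c2 ⊗ c1).
Proof.
have := bialgebra_comult_mult hb proj2_factors proj1_factors
  inj2_factors inj1_factors.
rewrite cross_comult_proj21 (cross_mult_inj21 hBAT) => ->.
rewrite proj2_inj2 (proj1_inj1 hBAT).
rewrite !(comp_id_dom (hom_id _)) !tens_id (comp_id_dom (lift1_hom hBAT)).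
rewrite (comp_id_dom (lift2_hom hBAT)).
by rewrite (comp_id_cod (colift1_hom hBAT)) (comp_id_cod (colift2_hom hBAT)).
Qed.

(** With [p2] on both legs, the left strand of the crossing is cut down to [B2] while the right one
    remains all of [H]. *)
Lemma comult_act_r :
  Delta B2 ∘ mu_r
  = (l2 ⊗ mu_r) ∘ (id2 ⊗ braid B2 (B1 ⊠ B2) ⊗ id1) ∘ (Delta B2 ⊗ c1).
Proof.
have := bialgebra_comult_mult hb proj2_factors proj2_factors
  inj2_factors inj1_factors.
rewrite cross_comult_proj2 (cross_mult_inj21 hBAT).
rewrite -comp_assoc; typecheck.
rewrite -/mu_r => ->.
rewrite proj2_inj2 (comp_id_dom (proj2_hom hBAT)) (comp_id_cod (inj1_hom hBAT)).
rewrite !(comp_id_dom (hom_id _)) !tens_id (comp_id_dom (lift2_hom hBAT)).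
by rewrite (comp_id_cod (colift1_hom hBAT)) colift2_proj2 lift2_inj1.
Qed.

Lemma comult_mult1 :
  Delta B1 ∘ mult B1
  = (l1 ⊗ mult B1) ∘ (idH ⊗ Psi11 ⊗ id1) ∘ (c1 ⊗ Delta B1).
Proof.
have := bialgebra_comult_mult hb proj1_factors proj1_factors
  inj1_factors inj1_factors.
rewrite cross_comult_proj1 (cross_mult_inj1 hBAT).
rewrite -comp_assoc; typecheck.
rewrite (comp_assoc (h := p1)); typecheck.
rewrite (proj1_inj1 hBAT) (comp_id_cod (mult_hom (BAT_algebra1 hBAT))) => ->.
rewrite (comp_id_cod (inj1_hom hBAT)) (comp_id_dom (proj1_hom hBAT)).
rewrite !(comp_id_dom (hom_id _)) !tens_id !(comp_id_dom (lift1_hom hBAT)).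
rewrite colift1_proj1.
have hl := lift1_hom hBAT; have hD := Delta_hom (BAT_coalgebra1 hBAT).
(* The sliding formula leaves [i1] before the braiding. Writing [mult B1] through [l1] puts [i1]
   after it on the other side, and naturality matches the two. *)
have -> : l1 ⊗ mult B1 = (l1 ⊗ l1) ∘ (idm (B1 ⊠ B2 ⊠ B1) ⊗ (i1 ⊗ id1)).
  by rewrite -tens_comp ?(lift1_inj1 hBAT) ?(comp_id_dom hl); typecheck.
have -> : ((idH ⊗ i1) ∘ c1) ⊗ Delta B1
    = (idH ⊗ i1 ⊗ idm (B1 ⊠ B1)) ∘ (c1 ⊗ Delta B1).
  by rewrite -tens_comp ?(comp_id_cod hD); typecheck.
rewrite !comp_assoc; typecheck.
congr (_ ∘ _).
rewrite -!(comp_assoc (h := l1 ⊗ l1)); typecheck.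
congr (_ ∘ _).
have -> : idH ⊗ i1 ⊗ idm (B1 ⊠ B1) = idH ⊗ (i1 ⊗ id1) ⊗ id1.
  by rewrite -(tens_id (carrier B1) (carrier B1)) !tensA.
have -> : idm (B1 ⊠ B2 ⊠ B1) ⊗ (i1 ⊗ id1) = idH ⊗ (id1 ⊗ i1) ⊗ id1.
  by rewrite -(tens_id (B1 ⊠ B2)) !tensA.
rewrite -!tens_comp; typecheck.
by rewrite (braid_natural (inj1_hom hBAT) (hom_id _)).
Qed.

Lemma act_r_mult : mu_r ∘ (mult B2 ⊗ id1) = l2 ∘ (id2 ⊗ f21).
Proof.
rewrite /act_r -comp_assoc; typecheck.
rewrite (cross_mult2 hBAT) comp_assoc; typecheck.
rewrite proj2_cross_mult -comp_assoc; typecheck.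
rewrite -tens_comp; typecheck.
by rewrite proj2_inj2 (comp_id_cod (BAT_hom21 hBAT)).
Qed.

(** The hexagon splits the crossing into [Psi21] followed by [Psi22]; the first merges into the
    layer of [nu_l], the second into that of [mu_r]. *)
Lemma comult_act_r_hopf :
  Delta B2 ∘ mu_r
  = (mult B2 ⊗ mu_r) ∘ (mu_r ⊗ Psi22 ⊗ id1) ∘ (id2 ⊗ Psi21 ⊗ nu_l)
      ∘ (Delta B2 ⊗ Delta B1).
Proof.
have hm := mult_hom (BAT_algebra2 hBAT); have hr := act_r_hom hBAT.
have hD := Delta_hom (BAT_coalgebra2 hBAT); have hn := coact_l_hom hBAT.
rewrite comult_act_r braid_hexr.
have -> : l2 ⊗ mu_r = (mult B2 ⊗ mu_r) ∘ (mu_r ⊗ id2 ⊗ idm (B2 ⊠ B1)).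
  by rewrite -tens_comp ?(comp_id_dom hr); typecheck.
have -> : Delta B2 ⊗ c1
    = (idm (B2 ⊠ B2) ⊗ (id1 ⊗ nu_l)) ∘ (Delta B2 ⊗ Delta B1).
  by rewrite -tens_comp ?(comp_id_cod hD); typecheck.
have -> : mu_r ⊗ Psi22 ⊗ id1
    = (mu_r ⊗ id2 ⊗ idm (B2 ⊠ B1)) ∘ (id2 ⊗ (id1 ⊗ Psi22) ⊗ id1).
  (* Identities are regrouped so that both factors have matching blocks for interchange. *)
  have -> : mu_r ⊗ id2 ⊗ idm (B2 ⊠ B1) = mu_r ⊗ idm (B2 ⊠ B2) ⊗ id1.
    by rewrite -!tens_id !tensA.
  rewrite (tensA id2 id1) tens_id -!tens_comp; typecheck.
  rewrite (comp_id_dom hr) (comp_id_cod (braid_hom _ _)).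
  by rewrite (comp_id_cod (hom_id _)).
have -> : id2 ⊗ Psi21 ⊗ nu_l
    = (id2 ⊗ (Psi21 ⊗ id2) ⊗ id1) ∘ (idm (B2 ⊠ B2) ⊗ (id1 ⊗ nu_l)).
  have -> : id2 ⊗ (Psi21 ⊗ id2) ⊗ id1 = id2 ⊗ Psi21 ⊗ idm (B2 ⊠ B1).
    by rewrite -!tens_id !tensA.
  have -> : idm (B2 ⊠ B2) ⊗ (id1 ⊗ nu_l) = id2 ⊗ idm (B2 ⊠ B1) ⊗ nu_l.
    by rewrite -!tens_id !tensA.
  rewrite -!tens_comp; typecheck.
  rewrite (comp_id_cod hn) (comp_id_dom (braid_hom _ _)).
  by rewrite (comp_id_cod (hom_id _)).
have -> : id2 ⊗ ((id1 ⊗ Psi22) ∘ (Psi21 ⊗ id2)) ⊗ id1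
    = (id2 ⊗ (id1 ⊗ Psi22) ⊗ id1) ∘ (id2 ⊗ (Psi21 ⊗ id2) ⊗ id1).
  do 2 (rewrite -[in RHS]tens_comp; typecheck).
  by rewrite !(comp_id_cod (hom_id _)).
by rewrite !comp_assoc; typecheck.
Qed.

Lemma comult_mult1_hopf :
  Delta B1 ∘ mult B1
  = (mult B1 ⊗ mult B1) ∘ (id1 ⊗ mu_l ⊗ id1 ⊗ id1)
      ∘ (id1 ⊗ id2 ⊗ Psi11 ⊗ id1) ∘ (id1 ⊗ nu_l ⊗ id1 ⊗ id1)
      ∘ (Delta B1 ⊗ Delta B1).
Proof.
have hm := mult_hom (BAT_algebra1 hBAT).
have hD := Delta_hom (BAT_coalgebra1 hBAT).
rewrite comult_mult1.
have -> : l1 ⊗ mult B1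
    = (mult B1 ⊗ mult B1) ∘ (id1 ⊗ mu_l ⊗ id1 ⊗ id1).
  rewrite -tensA tens_id -tens_comp; typecheck.
  by rewrite (comp_id_dom hm).
have -> : c1 ⊗ Delta B1
    = (id1 ⊗ nu_l ⊗ id1 ⊗ id1) ∘ (Delta B1 ⊗ Delta B1).
  rewrite -(tensA (id1 ⊗ nu_l)) tens_id -tens_comp; typecheck.
  by rewrite (comp_id_cod hD).
by rewrite tens_id !comp_assoc; typecheck.
Qed.

(** The two hexagons split the braiding of [H] with itself into [Psi21], then [Psi11 ⊗ Psi22], then
    [Psi12]. The first and last merge into the layers of coactions and actions. *)
Lemma module_comodule_hopf :
  f12 ∘ f21
  = (mult B2 ⊗ mult B1) ∘ (mu_r ⊗ Psi12 ⊗ mu_l)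
      ∘ (id2 ⊗ Psi11 ⊗ Psi22 ⊗ id1) ∘ (nu_r ⊗ Psi21 ⊗ nu_l)
      ∘ (Delta B2 ⊗ Delta B1).
Proof.
have hr := act_r_hom hBAT; have hl := act_l_hom hBAT.
have hnr := coact_r_hom hBAT; have hnl := coact_l_hom hBAT.
rewrite act_module_comodule.
have -> : l2 ⊗ l1
    = (mult B2 ⊗ mult B1) ∘ (mu_r ⊗ idm (B2 ⊠ B1) ⊗ mu_l).
  by rewrite -tens_id (tensA mu_r) -(tensA (mu_r ⊗ id2)) -tens_comp; typecheck.
have -> : c2 ⊗ c1
    = (nu_r ⊗ idm (B2 ⊠ B1) ⊗ nu_l) ∘ (Delta B2 ⊗ Delta B1).
  by rewrite -tens_id (tensA nu_r) -(tensA (nu_r ⊗ id2)) -tens_comp; typecheck.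
have -> : braid (B1 ⊠ B2) (B1 ⊠ B2)
    = (id1 ⊗ Psi12 ⊗ id2) ∘ (Psi11 ⊗ Psi22) ∘ (id1 ⊗ Psi21 ⊗ id2).
  rewrite braid_hexl !braid_hexr tens_compl; typecheck.
  rewrite tens_compr; typecheck.
  rewrite !comp_assoc; typecheck.
  rewrite (tens_splitlr (braid_hom B1 B1) (braid_hom B2 B2)) -!tens_id !tensA.
  by rewrite !comp_assoc; typecheck.
have -> : mu_r ⊗ Psi12 ⊗ mu_l
    = (mu_r ⊗ idm (B2 ⊠ B1) ⊗ mu_l) ∘ (id2 ⊗ (id1 ⊗ Psi12 ⊗ id2) ⊗ id1).
  have -> : id2 ⊗ (id1 ⊗ Psi12 ⊗ id2) ⊗ id1
      = idm (B2 ⊠ B1) ⊗ Psi12 ⊗ idm (B2 ⊠ B1) by rewrite -!tens_id !tensA.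
  rewrite -!tens_comp; typecheck.
  by rewrite (comp_id_dom hr) (comp_id_dom hl) (comp_id_cod (braid_hom _ _)).
have -> : nu_r ⊗ Psi21 ⊗ nu_l
    = (id2 ⊗ (id1 ⊗ Psi21 ⊗ id2) ⊗ id1) ∘ (nu_r ⊗ idm (B2 ⊠ B1) ⊗ nu_l).
  have -> : id2 ⊗ (id1 ⊗ Psi21 ⊗ id2) ⊗ id1
      = idm (B2 ⊠ B1) ⊗ Psi21 ⊗ idm (B2 ⊠ B1) by rewrite -!tens_id !tensA.
  rewrite -!tens_comp; typecheck.
  by rewrite (comp_id_cod hnr) (comp_id_cod hnl) (comp_id_dom (braid_hom _ _)).
rewrite -(tensA id2 Psi11) tens_compr ?tens_compl; typecheck.
rewrite tens_compr ?tens_compl; typecheck.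
by rewrite !comp_assoc; typecheck.
Qed.

End CrossProductHopf.

(** * Assembly of the Hopf datum from one axiom in each symmetry orbit *)

Theorem proposition2p7 (C : strict_braided_category)
    (splitC : split_idempotents C)
    (B1 B2 : algcoalg_data C) (vphi12 vphi21 : mor C)
    (hBAT : is_BAT B1 B2 vphi12 vphi21) :
  let mu_l := (idm B1 ⊗ eps B2) ∘ vphi21 in
  let mu_r := (eps B1 ⊗ idm B2) ∘ vphi21 in
  let nu_l := vphi12 ∘ (idm B1 ⊗ eta B2) in
  let nu_r := vphi12 ∘ (eta B1 ⊗ idm B2) in
  is_hopf_datum B1 B2 mu_l nu_l mu_r nu_r /\
  hopf_phi12 B1 B2 nu_l nu_r = vphi12 /\
  hopf_phi21 B1 B2 mu_l mu_r = vphi21.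
Proof.
move=> mu_l mu_r nu_l nu_r.
have hR := BAT_rev hBAT; have hO := BAT_op hBAT; have hRO := BAT_rev hO.
have hl : hom (B2 ⊠ B1) B1 mu_l := act_l_hom hBAT.
have hr : hom (B2 ⊠ B1) B2 mu_r := act_r_hom hBAT.
have kl : hom B1 (B2 ⊠ B1) nu_l := coact_l_hom hBAT.
have kr : hom B2 (B2 ⊠ B1) nu_r := coact_r_hom hBAT.
have e21 : hopf_phi21 B1 B2 mu_l mu_r = vphi21 := hopf_phi21_act hBAT.
(* This is the dual of [e21], up to bracketing of the composite. *)
have e12 : hopf_phi12 B1 B2 nu_l nu_r = vphi12.
  by rewrite -[RHS](hopf_phi21_act hO) /hopf_phi12 -comp_assoc; typecheck.
split; last by [].
(* With both composites replaced by the BAT maps, each axiom is a proved one read in [C] ([hBAT]),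
   its mirror ([hR]), its dual ([hO]) or the mirrored dual ([hRO]). *)
split; rewrite ?e12 ?e21.
- exact: BAT_algebra1 hBAT.
- exact: BAT_coalgebra1 hBAT.
- exact: eps1_algebra_morphism hBAT.
- exact: unit_coalgebra_morphism_op (eps1_algebra_morphism hO).
- exact: BAT_algebra2 hBAT.
- exact: BAT_coalgebra2 hBAT.
- exact: eps2_algebra_morphism hBAT.
- exact: unit_coalgebra_morphism_op (eps2_algebra_morphism hO).
- by split; [| exact: act_l_mult hBAT | exact: cross_act_l_eta2 hBAT].
- by split; [| exact: act_l_mult hO | exact: cross_act_l_eta2 hO].
- by split; [| exact: act_l_mult hR | exact: cross_act_l_eta2 hR].
- by split; [| exact: act_l_mult hRO | exact: cross_act_l_eta2 hRO].
- exact: act_r_eta2 hBAT.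
- exact: act_r_eta2 hRO.
- exact: eps1_act_l hR.
- exact: eps1_act_l hBAT.
- exact: act_r_eta2 hR.
- exact: act_r_eta2 hO.
- exact: eps1_act_l hRO.
- exact: eps1_act_l hO.
- exact: comult_mult1_hopf hBAT.
- have := comult_mult1_hopf hR; rewrite /= !tensA; exact.
- exact: module_comodule_hopf hBAT.
- exact: act_r_mult hBAT.
- exact: act_r_mult hR.
- rewrite -comp_assoc; typecheck.
  exact: act_r_mult hO.
- rewrite -comp_assoc; typecheck.
  exact: act_r_mult hRO.
- exact: comult_act_r_hopf hBAT.
- have := comult_act_r_hopf hR; rewrite /= !tensA; exact.
- have := comult_act_r_hopf hO.
  rewrite /= !comp_assoc; typecheck.
  exact.
- have := comult_act_r_hopf hRO.
  rewrite /= !tensA !comp_assoc; typecheck.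
  exact.
Qed.
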